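(* In the trilevel setting, assume $\limsup_{k\to\infty}\beta_k/\alpha_k=0$, $\alpha_k\to0$, $\sum_k\alpha_k=\infty$, and $\limsup_{k\to\infty}\frac{|\beta_k-\beta_{k-1}|+|\alpha_k-\alpha_{k-1}|}{\alpha_k\beta_k}=0$. Then the trilevel iteration sequence $\{x^k\}$ converges to the unique $x^*\in\mathrm{Fix}(W)$ satisfying \[\langle x^*-S(x^* ),x-x^*\rangle\ge0\quad\forall x\in\mathrm{Fix}(W),\] i.e. $\omega(x^* )=\min_{x\in Y^*}\omega(x)$.
   Context: Trilevel setting. Let $f_1,f_2:\mathbb R^n\to\mathbb R$ be convex and continuously differentiable with $L_{f_i}$-Lipschitz gradients, and $g_1,g_2:\mathbb R^n\to(-\infty,+\infty]$ proper, lower semicontinuous and convex; put $\phi_i=f_i+g_i$. Let $\omega:\mathbb R^n\to\mathbb R$ be $\mu$-strongly convex and continuously differentiable with $L_\omega$-Lipschitz gradient. Let $Y^*=\arg\min_{x\in\mathbb R^n}\phi_2(x)$ and $X^*=\arg\min_{x\in Y^*}\phi_1(x)$, both assumed nonempty. For a proper lsc convex $g$, $\mathrm{prox}_g(x)=\arg\min_{u}\{g(u)+\tfrac12\|u-x\|^2\}$. Fix $u\in(0,\tfrac{2}{L_\omega+\mu}]$, $t\in(0,1/L_{f_1}]$, $s\in(0,1/L_{f_2}]$ and define $S(x)=x-u\nabla\omega(x)$, $T(x)=\mathrm{prox}_{tg_1}(x-t\nabla f_1(x))$, $W(x)=\mathrm{prox}_{sg_2}(x-s\nabla f_2(x))$.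 Then $S$ is a contraction with constant $r=\sqrt{1-\tfrac{2u\mu L_\omega}{\mu+L_\omega}}\in[0,1)$, $T,W$ are nonexpansive, $\mathrm{Fix}(W)=Y^*$. Given $x^0\in\mathbb R^n$ and real sequences $\alpha_k,\beta_k\in(0,1)$, the trilevel iteration sequence is $x^{k+1}=\alpha_kS(x^k)+(1-\alpha_k)\beta_kT(x^k)+(1-\alpha_k)(1-\beta_k)W(x^k)$, $k\ge0$. *)

(* Defs.v *)
From HB Require Import structures.
From mathcomp Require Import all_boot all_order all_algebra.
From mathcomp Require Import all_classical all_reals all_analysis.
Set Implicit Arguments. Unset Strict Implicit. Unset Printing Implicit Defensive.
Import Order.TTheory GRing.Theory Num.Theory.
Import numFieldNormedType.Exports.
Local Open Scope ring_scope.
Local Open Scope classical_set_scope.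

Section Defs.
Variables (R : realType) (n : nat).
Notation vec := 'rV[R]_n.

Definition dotv (u v : vec) : R := \sum_(i < n) u ord0 i * v ord0 i.
Definition enorm (u : vec) : R := Num.sqrt (dotv u u).

Definition is_gradient (f : vec -> R) (gf : vec -> vec) : Prop :=
  forall x, differentiable f x /\ forall h, 'd f x h = dotv (gf x) h.

Definition lipschitz_with (L : R) (F : vec -> vec) : Prop :=
  forall x y, enorm (F x - F y) <= L * enorm (x - y).

Definition convex_fun (f : vec -> R) : Prop :=
  forall x y (a : R), 0 <= a <= 1 ->
    f (a *: x + (1 - a) *: y) <= a * f x + (1 - a) * f y.

Definition strongly_convex (mu : R) (f : vec -> R) : Prop :=
  forall x y (a : R), 0 <= a <= 1 ->
    f (a *: x + (1 - a) *: y) <=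
      a * f x + (1 - a) * f y - mu / 2 * a * (1 - a) * enorm (x - y) ^+ 2.

Definition proper_efun (g : vec -> \bar R) : Prop :=
  (forall x, g x != -oo%E) /\ (exists x, g x != +oo%E).

Definition convex_efun (g : vec -> \bar R) : Prop :=
  forall x y (a : R), 0 < a < 1 ->
    (g (a *: x + (1 - a) *: y)%R <= a%:E * g x + (1 - a)%:E * g y)%E.

Definition is_prox (c : R) (g : vec -> \bar R) (x p : vec) : Prop :=
  forall u, (c%:E * g p + (enorm (p - x)%R ^+ 2 / 2)%:E <=
             c%:E * g u + (enorm (u - x)%R ^+ 2 / 2)%:E)%E.

Definition is_argmin_on (A : set vec) (h : vec -> \bar R) (x : vec) : Prop :=
  A x /\ forall y, A y -> (h x <= h y)%E.

End Defs.

(* Main.v *)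
Require Import Defs.
From HB Require Import structures.
From mathcomp Require Import all_boot all_order all_algebra.
From mathcomp Require Import all_classical all_reals all_analysis.
From mathcomp Require Import ring lra.
Set Implicit Arguments.
Unset Strict Implicit.
Unset Printing Implicit Defensive.
Import Order.TTheory GRing.Theory Num.Theory.
Import numFieldNormedType.Exports.
Local Open Scope ring_scope.
Local Open Scope classical_set_scope.

(** Since [beta k = o(alpha k)], the [T]-term only perturbs the viscosity
    iteration [alpha S + (1 - alpha) W] by [o(alpha)].  The iterates are bounded,
    and comparing two consecutive steps gives [x (k+1) - x k -> 0], hence
    [x k - W (x k) -> 0].  By compactness, almost fixed points [z] of [W] in a
    bounded set satisfy [<S xs - xs, z - xs> <= e], where [xs] minimizes the
    strongly convex [om] over the closed convex set [Fix W]; so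
    [|x k - xs|^2] obeys a damped recursion
    [a (k+1) <= (1 - g alpha k) a k + alpha k d k] with [limsup d <= 0].
    Nonexpansiveness of [T], [W] and contractivity of [S] rest on the
    Baillon-Haddad cocoercivity of Lipschitz gradients of convex functions. *)

(** * Euclidean inner product and norm on row vectors, compared with the sup norm *)

Section Euclidean.
Variables (R : realType) (n : nat).
Implicit Types (u v w : 'rV[R]_n) (a : R).

Lemma dotvC u v : dotv u v = dotv v u.
Proof. by apply: eq_bigr => i _; rewrite mulrC. Qed.

Lemma dotvDl u v w : dotv (u + v) w = dotv u w + dotv v w.
Proof. by rewrite -big_split; apply: eq_bigr => i _; rewrite mxE mulrDl. Qed.

Lemma dotvZl a u w : dotv (a *: u) w = a * dotv u w.
Proof. by rewrite /dotv mulr_sumr; apply: eq_bigr => i _; rewrite mxE mulrA. Qed.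

Lemma dotvNl u w : dotv (- u) w = - dotv u w.
Proof. by rewrite -scaleN1r dotvZl mulN1r. Qed.

Lemma dotvDr u v w : dotv w (u + v) = dotv w u + dotv w v.
Proof. by rewrite !(dotvC w) dotvDl. Qed.

Lemma dotvZr a u w : dotv w (a *: u) = a * dotv w u.
Proof. by rewrite !(dotvC w) dotvZl. Qed.

Lemma dotvNr u w : dotv w (- u) = - dotv w u.
Proof. by rewrite !(dotvC w) dotvNl. Qed.

Definition dotE := (dotvDl, dotvDr, dotvNl, dotvNr, dotvZl, dotvZr).

Lemma dotvv_ge0 u : 0 <= dotv u u.
Proof. by apply: sumr_ge0 => i _; rewrite -expr2 sqr_ge0. Qed.

Lemma enorm_ge0 u : 0 <= enorm u.
Proof. exact: sqrtr_ge0. Qed.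

Lemma enorm_sqr u : enorm u ^+ 2 = dotv u u.
Proof. by rewrite sqr_sqrtr // dotvv_ge0. Qed.

Lemma enorm0 : enorm (0 : 'rV[R]_n) = 0.
Proof. by rewrite /enorm -(scale0r (0 : 'rV[R]_n)) dotvZl mul0r sqrtr0. Qed.

Lemma enormZ a u : enorm (a *: u) = `|a| * enorm u.
Proof. by rewrite /enorm dotvZl dotvZr mulrA -expr2 sqrtrM ?sqr_ge0// sqrtr_sqr. Qed.

Lemma enormN u : enorm (- u) = enorm u.
Proof. by rewrite -scaleN1r enormZ normrN1 mul1r. Qed.

Lemma enormB u v : enorm (u - v) = enorm (v - u).
Proof. by rewrite -opprB enormN. Qed.

Lemma coord_le_enorm u i : `|u ord0 i| <= enorm u.
Proof.
rewrite -sqrtr_sqr; apply: ler_wsqrtr; rewrite /dotv (bigD1 i) //= -expr2 lerDl.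
by apply: sumr_ge0 => j _; rewrite -expr2 sqr_ge0.
Qed.

Lemma mx_norm_le_enorm u : `|u| <= enorm u.
Proof.
rewrite [leLHS]mx_normrE.
elim/big_ind: _ => [|a b ha hb|[i j] _ /=]; first exact: enorm_ge0.
- by rewrite ge_max ha hb.
- by rewrite (ord1 i) coord_le_enorm.
Qed.

Lemma enorm_eq0 u : enorm u = 0 -> u = 0.
Proof.
move=> u0; apply/rowP => i; rewrite mxE; apply/eqP.
by rewrite -normr_le0 -u0 coord_le_enorm.
Qed.

Lemma subr_enorm_eq0 u v : enorm (u - v) = 0 -> u = v.
Proof. by move/enorm_eq0/eqP; rewrite subr_eq0 => /eqP. Qed.

(** Expand the squared length of [dotv v v *: u - dotv u v *: v]: it is [dotv v v] times the defect
    of the inequality. *)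
Lemma dotv_sqr_le u v : dotv u v ^+ 2 <= dotv u u * dotv v v.
Proof.
have [v0|v0] := eqVneq (dotv v v) 0.
  have -> : v = 0 by apply: enorm_eq0; rewrite /enorm v0 sqrtr0.
  by rewrite -(scale0r (0 : 'rV[R]_n)) !dotE !mul0r expr0n /= mulr0.
have vp : 0 < dotv v v by rewrite lt_neqAle eq_sym v0 dotvv_ge0.
have := dotvv_ge0 (dotv v v *: u - dotv u v *: v).
rewrite !dotE (dotvC v u) => h.
rewrite -subr_ge0 -(pmulr_rge0 _ vp).
by apply: le_trans h _; rewrite le_eqVlt; apply/orP; left; apply/eqP; ring.
Qed.

Lemma cauchy_schwarz u v : `|dotv u v| <= enorm u * enorm v.
Proof.
rewrite -sqrtrM ?dotvv_ge0// -sqrtr_sqr.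
by apply: ler_wsqrtr; exact: dotv_sqr_le.
Qed.

Lemma dotv_le_enorm u v : dotv u v <= enorm u * enorm v.
Proof. exact: le_trans (ler_norm _) (cauchy_schwarz _ _). Qed.

Lemma enormD u v : enorm (u + v) <= enorm u + enorm v.
Proof.
rewrite -(ler_pXn2r (ltn0Sn 1)) ?nnegrE ?addr_ge0 ?enorm_ge0//.
rewrite sqrrD !enorm_sqr !dotE (dotvC v u).
have := dotv_le_enorm u v; lra.
Qed.

Lemma enormD3 u v w : enorm (u + v + w) <= enorm u + enorm v + enorm w.
Proof. by apply: le_trans (enormD _ _) _; rewrite lerD2r enormD. Qed.

Lemma enorm_trian w u v : enorm (u - v) <= enorm (u - w) + enorm (w - v).
Proof. by rewrite (_ : u - v = u - w + (w - v)) ?enormD// addrA subrK. Qed.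

Lemma enorm_le_mx_norm u : enorm u <= Num.sqrt n%:R * `|u|.
Proof.
rewrite -[`|u|]normr_id -sqrtr_sqr -sqrtrM ?ler0n//; apply: ler_wsqrtr.
apply: (@le_trans _ _ (\sum_(i < n) `|u| ^+ 2)).
  apply: ler_sum => i _; rewrite -expr2 -real_normK ?num_real//.
  rewrite ler_pXn2r ?nnegrE//.
  rewrite [leRHS]mx_normrE.
  exact: (le_bigmax _ (fun ij : 'I_1 * 'I_n => `|u ij.1 ij.2|) (ord0, i)).
by rewrite sumr_const card_ord mulr_natl lexx.
Qed.

(** The topology on row vectors comes from the sup norm, so the comparison factor [Num.sqrt n%:R]
    enters. *)
Lemma enorm_lipschitz_continuous (C : R) (f : 'rV[R]_n -> R) :
  (forall x y, `|f x - f y| <= C * enorm (x - y)) -> continuous f.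
Proof.
move=> lipf x; apply/(@cvgrPdist_lt _ R _ (nbhs (x : 'rV[R]_n)) _ f) => e e0.
have C0 : 0 < `|C| * Num.sqrt n%:R + 1.
  by rewrite ltr_wpDl// mulr_ge0// sqrtr_ge0.
have := @nbhsx_ballx _ _ (x : 'rV[R]_n) _ (divr_gt0 e0 C0).
apply: filterS => y.
rewrite -ball_normE /= => xy.
apply: le_lt_trans (lipf _ _) _.
apply: (@le_lt_trans _ _ ((`|C| * Num.sqrt n%:R + 1) * `|x - y|)).
  rewrite mulrDl mul1r ler_wpDr// -mulrA.
  apply: le_trans (ler_wpM2r (enorm_ge0 _) (ler_norm C)) _.
  by rewrite ler_wpM2l ?enorm_le_mx_norm.
by rewrite mulrC -ltr_pdivlMr.
Qed.

Lemma closed_sublevel (C : R) (f : 'rV[R]_n -> R) (B : R) :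
  (forall x y, `|f x - f y| <= C * enorm (x - y)) -> closed [set x | f x <= B].
Proof.
move=> lipf.
apply: (@preimage_closed _ _ f [set y | y <= B]); last exact: closed_le.
by move=> x _; exact: (@enorm_lipschitz_continuous C f lipf x).
Qed.

Lemma enorm_lipschitz (c x y : 'rV[R]_n) :
  `|enorm (x - c) - enorm (y - c)| <= enorm (x - y).
Proof.
have := enorm_trian y x c; have := enorm_trian x y c.
rewrite (enormB y x) ler_norml; lra.
Qed.

Lemma compact_enorm_ball (A : set 'rV[R]_n) (c : 'rV[R]_n) (B : R) :
  closed A -> compact (A `&` [set x | enorm (x - c) <= B]).
Proof.
move=> clA; apply: bounded_closed_compact.
  exists (B + enorm c); split; first exact: num_real.
  move=> M BM x [_ /= xB].
  apply: le_trans (ltW BM); apply: le_trans (mx_norm_le_enorm _) _.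
  by rewrite -[x in enorm x](subrK c); apply: le_trans (enormD _ _) _; rewrite lerD2r.
apply: closedI => //; apply: (@closed_sublevel 1) => x y.
by rewrite mul1r; exact: enorm_lipschitz.
Qed.
End Euclidean.

(** * Derivatives along lines and the quadratic upper bound *)

Section Descent.
Variables (R : realType) (n : nat) (f : 'rV[R]_n -> R) (gf : 'rV[R]_n -> 'rV[R]_n).
Hypothesis gradf : is_gradient f gf.

Lemma is_derive_line (x d : 'rV[R]_n) (a : R) :
  is_derive a 1 (fun b : R => f (x + b *: d)) (dotv (gf (x + a *: d)) d).
Proof.
have [df dfE] := gradf (x + a *: d).
have quotE : (fun h : R => h^-1 *: (f (x + (h *: 1 + a) *: d) - f (x + a *: d))) =
             (fun h : R => h^-1 *: (f (h *: d + (x + a *: d)) - f (x + a *: d))).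
  by apply/funext => h; rewrite [h *: 1]mulr1 scalerDl addrCA.
apply: DeriveDef.
  by rewrite /derivable /= quotE; exact: diff_derivable.
by rewrite /derive /= quotE -dfE -deriveE.
Qed.

Lemma descent_lemma (L : R) (x y : 'rV[R]_n) : lipschitz_with L gf ->
  f y <= f x + dotv (gf x) (y - x) + L / 2 * dotv (y - x) (y - x).
Proof.
move=> lipg; set d := y - x.
(* The claim is [phi 1 <= phi 0]. By the mean value theorem it suffices that [dphi] is nonpositive
   on (0, 1), which follows from Cauchy-Schwarz and the Lipschitz bound. *)
pose phi (a : R) := f (x + a *: d) - a * dotv (gf x) d - a ^+ 2 * (L / 2 * dotv d d).
pose dphi (a : R) := dotv (gf (x + a *: d)) d - dotv (gf x) d - a * (L * dotv d d).
have dphiP (a : R) : is_derive a 1 phi (dphi a).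
  have D := is_derive_line x d a.
  rewrite /phi /dphi.
  apply: is_derive_eq.
  rewrite !scaler0 !add0r /GRing.scale /=; lra.
have [|] := @MVT R phi dphi 0 1 ltr01 (fun a _ => dphiP a).
  apply: continuous_subspaceT => a.
  by apply/differentiable_continuous/derivable1_diffP; have [] := dphiP a.
move=> c; rewrite in_itv /= => /andP[c0 c1].
rewrite subr0 mulr1 /phi /dphi.
rewrite !scale1r !scale0r addr0 mul0r mul1r expr1n mul1r expr0n /= mul0r !subr0.
rewrite [x + d](_ : _ = y); last by rewrite /d addrC subrK.
suff : dotv (gf (x + c *: d)) d - dotv (gf x) d <= c * (L * dotv d d) by lra.
rewrite -dotvNl -dotvDl.
apply: le_trans (dotv_le_enorm _ _) _.
apply: le_trans (ler_wpM2r (enorm_ge0 _) (lipg _ _)) _.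
rewrite (_ : x + c *: d - x = c *: d); last by rewrite addrC addKr.
rewrite enormZ (gtr0_norm c0) -enorm_sqr; lra.
Qed.
End Descent.

(** Let [a] tend to 0. This plays the role of one-sided derivatives in the first-order conditions
    below. *)
Lemma le0_of_le_small (R : realType) (A K : R) :
  (forall a, 0 < a < 1 -> A <= a * K) -> A <= 0.
Proof.
move=> h; rewrite leNgt; apply/negP => A0.
have K0 : 0 < `|K| + A by rewrite ltr_wpDl.
have : A <= A / 2 / (`|K| + A) * K.
  apply: h; rewrite !divr_gt0//= ltr_pdivrMr// mul1r.
  have := normr_ge0 K; lra.
move=> {}h.
have : A / 2 / (`|K| + A) * K <= A / 2.
  rewrite mulrAC ler_pdivrMr// ler_wpM2l//; first by lra.
  have := ler_norm K; lra.
lra.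
Qed.

(** * Gradient inequalities and the explicit gradient step *)

Section GradientStep.
Variables (R : realType) (n : nat) (f : 'rV[R]_n -> R) (gf : 'rV[R]_n -> 'rV[R]_n).
Variables (L : R).
Hypotheses (gradf : is_gradient f gf) (L0 : 0 < L) (lipg : lipschitz_with L gf).

Lemma strongly_convex_gradient_le (mu : R) (x y : 'rV[R]_n) :
  0 <= mu -> strongly_convex mu f ->
  f x + dotv (gf x) (y - x) + mu / 2 * dotv (y - x) (y - x) <= f y.
Proof.
move=> mu0 scf.
have [d {y}->] : exists d, y = x + d by exists (y - x); rewrite addrC subrK.
rewrite (_ : x + d - x = d); last by rewrite addrC addKr.
set y := x + d.
suff : f x + dotv (gf x) d + mu / 2 * dotv d d - f y <= 0 by lra.
(* Strong convexity at [x + a *: d] is compared with a lower bound of [f] there. The second-order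
   errors are [L / 2] from the descent lemma, [L] from moving the gradient back to [x], and [mu / 2]
   from the factor [1 - a]. *)
apply: (@le0_of_le_small _ _ ((3 * L / 2 + mu / 2) * dotv d d)) => a /andP[a0 a1].
have := scf y x a; rewrite ltW//= ltW// => /(_ isT).
rewrite enorm_sqr (_ : y - x = d); last by rewrite /y addrC addKr.
have -> : a *: y + (1 - a) *: x = x + a *: d.
  by rewrite /y scalerDr scalerBl scale1r addrAC addrCA subrr addr0.
have := descent_lemma gradf (x + a *: d) x lipg.
have -> : x - (x + a *: d) = - (a *: d) by rewrite opprD addrA subrr add0r.
rewrite !dotE => h1 h2.
have h3 : dotv (gf x) d - dotv (gf (x + a *: d)) d <= a * (L * dotv d d).
  rewrite -dotvNl -dotvDl.
  apply: le_trans (dotv_le_enorm _ _) _.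
  apply: le_trans (ler_wpM2r (enorm_ge0 _) (lipg _ _)) _.
  rewrite (_ : x - (x + a *: d) = - (a *: d)); last by rewrite opprD addrA subrr add0r.
  by rewrite enormN enormZ (gtr0_norm a0) -enorm_sqr; lra.
have {}h3 : a * (dotv (gf x) d - dotv (gf (x + a *: d)) d) <= a * (a * (L * dotv d d)).
  by rewrite ler_pM2l.
rewrite -(ler_pM2l a0). lra.
Qed.

Lemma convex_strongly0 : convex_fun f -> strongly_convex 0 f.
Proof. by move=> cf x y a a01; rewrite !mul0r subr0; exact: cf. Qed.

Lemma convex_gradient_le (x y : 'rV[R]_n) :
  convex_fun f -> f x + dotv (gf x) (y - x) <= f y.
Proof.
move=> /convex_strongly0 cf.
by have := strongly_convex_gradient_le x y (lexx _) cf; rewrite !mul0r addr0.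
Qed.

Lemma strongly_convex_convex (mu : R) :
  0 <= mu -> strongly_convex mu f -> convex_fun f.
Proof.
move=> mu0 scf x y a a01; apply: le_trans (scf _ _ _ a01) _.
rewrite gerBl; case/andP: a01 => a0 a1.
by rewrite !mulr_ge0 ?exprn_ge0 ?enorm_ge0 ?subr_ge0 ?invr_ge0.
Qed.

Lemma strongly_convex_monotone (mu : R) (x y : 'rV[R]_n) :
  0 <= mu -> strongly_convex mu f ->
  mu * dotv (x - y) (x - y) <= dotv (gf x - gf y) (x - y).
Proof.
move=> mu0 scf.
have := strongly_convex_gradient_le x y mu0 scf.
have := strongly_convex_gradient_le y x mu0 scf.
rewrite !dotE; rewrite (dotvC x y); lra.
Qed.

(* Baillon-Haddad: evaluate the gradient inequality at [x] and the descent lemma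
   at [y] in the common point [y - L^-1 (gf y - gf x)], then symmetrize. *)
Lemma gradient_cocoercive (x y : 'rV[R]_n) : convex_fun f ->
  dotv (gf x - gf y) (gf x - gf y) <= L * dotv (gf x - gf y) (x - y).
Proof.
move=> cf.
have half a b : f a + dotv (gf a) (b - a) +
    L^-1 / 2 * dotv (gf b - gf a) (gf b - gf a) <= f b.
  set D := gf b - gf a; set z := b - L^-1 *: D.
  have h1 := convex_gradient_le a z cf.
  have h2 := descent_lemma gradf b z lipg.
  have zb : z - b = - (L^-1 *: D) by rewrite /z addrAC subrr add0r.
  have za : z - a = (b - a) - L^-1 *: D by rewrite /z addrAC.
  have DD : dotv D D = dotv (gf b) D - dotv (gf a) D by rewrite {1}/D !dotE.
    move: h1 h2; rewrite zb za {za zb}; clearbody z; move: (D) DD => {}D DD.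
  rewrite dotvDr !(dotvNl, dotvNr, dotvZl, dotvZr).
  have -> : L / 2 * - - (L^-1 * (L^-1 * dotv D D)) = L^-1 / 2 * dotv D D.
    by field; rewrite gt_eqF.
  have := congr1 ( *%R L^-1) DD; rewrite mulrBr; lra.
have := half x y; have := half y x.
have -> : dotv (gf y - gf x) (gf y - gf x) = dotv (gf x - gf y) (gf x - gf y).
  by rewrite -opprB dotvNl dotvNr opprK.
set K := dotv (gf x - gf y) (gf x - gf y).
rewrite !dotE => h1 h2.
rewrite mulrC -ler_pdivrMr// mulrC; lra.
Qed.

(** Expand the square; cocoercivity absorbs the term in [t ^+ 2] into the cross term. Monotonicity
    of the gradient then yields nonexpansiveness, strong monotonicity yields contraction. *)
Lemma gradient_step_sqr_le (t : R) (x y : 'rV[R]_n) : convex_fun f -> 0 <= t ->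
  dotv (x - t *: gf x - (y - t *: gf y)) (x - t *: gf x - (y - t *: gf y)) <=
  dotv (x - y) (x - y) - t * (2 - t * L) * dotv (gf x - gf y) (x - y).
Proof.
move=> cf t0.
have -> : x - t *: gf x - (y - t *: gf y) = (x - y) - t *: (gf x - gf y).
  by rewrite scalerBr !opprB addrACA [RHS]addrACA [- y + _]addrC.
have := gradient_cocoercive x y cf.
set d := x - y; set D := gf x - gf y => h; clearbody d D.
rewrite !(dotvDl, dotvDr, dotvNl, dotvNr, dotvZl, dotvZr) (dotvC d D).
have : t * (t * dotv D D) <= t * (t * (L * dotv D d)) by rewrite !ler_wpM2l.
lra.
Qed.

Lemma gradient_step_nonexpansive (t : R) (x y : 'rV[R]_n) :
  convex_fun f -> 0 <= t -> t <= 1 / L ->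
  enorm (x - t *: gf x - (y - t *: gf y)) <= enorm (x - y).
Proof.
move=> cf t0 tL; apply: ler_wsqrtr.
apply: le_trans (gradient_step_sqr_le x y cf t0) _.
rewrite gerBl !mulr_ge0//.
  by move: tL; rewrite ler_pdivlMr// => tL; lra.
have := strongly_convex_monotone x y (lexx 0) (convex_strongly0 cf).
by rewrite mul0r.
Qed.

Lemma gradient_step_contraction (mu t : R) :
  0 < mu -> strongly_convex mu f -> 0 < t -> t <= 2 / (L + mu) ->
  exists r, [/\ 0 <= r, r < 1 &
    forall x y, enorm (x - t *: gf x - (y - t *: gf y)) <= r * enorm (x - y)].
Proof.
move=> mu0 scf t0 tL.
have cf := strongly_convex_convex (ltW mu0) scf.
have tL2 : 0 < 2 - t * L.
  move: tL; rewrite (ler_pdivlMr _ _ (addr_gt0 L0 mu0)) mulrDr => tL.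
  have : 0 < t * mu by rewrite mulr_gt0.
  lra.
(* This rate comes directly from [gradient_step_sqr_le] and strong monotonicity; it is below 1
   because [2 - t * L] is positive. *)
exists (Num.sqrt (1 - t * (2 - t * L) * mu)); split; first exact: sqrtr_ge0.
  by rewrite -[ltRHS]sqrtr1 ltr_sqrt ?ltr01// ltrBlDr ltrDl !mulr_gt0.
move=> x y.
have h : dotv (x - t *: gf x - (y - t *: gf y)) (x - t *: gf x - (y - t *: gf y)) <=
  (1 - t * (2 - t * L) * mu) * dotv (x - y) (x - y).
  apply: le_trans (gradient_step_sqr_le x y cf (ltW t0)) _.
  have := strongly_convex_monotone x y (ltW mu0) scf.
  rewrite -(ler_pM2l (mulr_gt0 t0 tL2)); lra.
(* [Num.sqrt] is 0 on negative numbers; in that case [h] makes the squared distance nonpositive, so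
   the factor 0 is correct. *)
have [r0|r0] := leP 0 (1 - t * (2 - t * L) * mu).
  by rewrite -sqrtrM//; apply: ler_wsqrtr.
rewrite (ler0_sqrtr (ltW r0)) mul0r -sqrtr0; apply: ler_wsqrtr.
by apply: le_trans h _; rewrite mulr_le0_ge0 ?dotvv_ge0 ?ltW.
Qed.
End GradientStep.

(** * Proximal points of extended-valued convex functions *)

Section Prox.
Variables (R : realType) (n : nat) (g : 'rV[R]_n -> \bar R).
Hypotheses (pg : proper_efun g) (cg : convex_efun g).
Variables (c : R).
Hypothesis c0 : 0 < c.

Lemma is_prox_fin_num x p : is_prox c g x p -> g p \is a fin_num.
Proof.
case: pg => gNy [w gwy] /(_ w).
rewrite fin_numE gNy /=; apply: contraPneq => ->.
case: (g w) (gNy w) gwy => [r||] //= _ _.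
by rewrite gt0_muley ?lte_fin// addye// leye_eq -EFinM -EFinD.
Qed.

(** The subgradient inclusion of [x - p] in [c] times the subdifferential of [g] at [p]: test
    minimality at [p + a *: d] and let [a] tend to 0. *)
Lemma is_prox_dotv_le x p w : is_prox c g x p -> g w \is a fin_num ->
  dotv (x - p) (w - p) <= c * (fine (g w) - fine (g p)).
Proof.
move=> px gw; have gp := is_prox_fin_num px.
have [d Ew] : exists d, w = p + d by exists (w - p); rewrite addrC subrK.
rewrite {w}Ew in gw *.
rewrite [p + d - p]addrC addKr.
suff : dotv (x - p) d - c * (fine (g (p + d)) - fine (g p)) <= 0 by lra.
apply: (@le0_of_le_small _ _ (dotv d d / 2)) => a /andP[a0 a1].
have := cg (p + d) p (a := a); rewrite a0 a1 => /(_ isT).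
have -> : a *: (p + d) + (1 - a) *: p = p + a *: d.
  by rewrite scalerDr scalerBl scale1r addrAC addrCA subrr addr0.
have := px (p + a *: d).
rewrite -(fineK gw) -(fineK gp) /=.
set z := p + a *: d.
case: (g z) (pg.1 z) => [r| |] //= _.
rewrite -!EFinM -!EFinD !lee_fin !enorm_sqr.
have -> : z - x = a *: d - (x - p) by apply/rowP => i; rewrite !mxE; ring.
rewrite -[p - x]opprB; move: (x - p) => e.
rewrite !dotE (dotvC e d) => h1 h2.
have {}h2 : c * r <= c * (a * fine (g (p + d)) + (1 - a) * fine (g p)).
  by rewrite ler_pM2l.
rewrite -(ler_pM2l a0); lra.
Qed.

(** Adding the two subgradient inequalities gives firm nonexpansiveness [h]; Cauchy-Schwarz and
    division by [enorm (p - q)] finish. *)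
Lemma is_prox_nonexpansive x y p q : is_prox c g x p -> is_prox c g y q ->
  enorm (p - q) <= enorm (x - y).
Proof.
move=> px qy; have gp := is_prox_fin_num px; have gq := is_prox_fin_num qy.
have := is_prox_dotv_le px gq; have := is_prox_dotv_le qy gp => h1 h2.
have h : dotv (p - q) (p - q) <= dotv (x - y) (p - q).
  move: h1 h2; rewrite !dotE; rewrite (dotvC q p); lra.
have [->|pq] := eqVneq (enorm (p - q)) 0; first exact: enorm_ge0.
have pq0 : 0 < enorm (p - q) by rewrite lt_neqAle eq_sym pq enorm_ge0.
rewrite -(ler_pM2r pq0) -expr2 enorm_sqr.
exact: le_trans h (dotv_le_enorm _ _).
Qed.
End Prox.

(** * The proximal gradient map and the minimizers of the composite objective *)

Section ProxGradient.
Variables (R : realType) (n : nat) (f : 'rV[R]_n -> R) (gf : 'rV[R]_n -> 'rV[R]_n).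
Variables (L : R) (g : 'rV[R]_n -> \bar R) (s : R) (P : 'rV[R]_n -> 'rV[R]_n).
Hypotheses (cf : convex_fun f) (gradf : is_gradient f gf).
Hypotheses (L0 : 0 < L) (lipg : lipschitz_with L gf).
Hypotheses (pg : proper_efun g) (cg : convex_efun g).
Hypotheses (s0 : 0 < s) (sL : s <= 1 / L) (proxP : forall z, is_prox s g z (P z)).
Local Notation argmin := (is_argmin_on setT (fun z => ((f z)%:E + g z)%E)).

Lemma prox_gradient_nonexpansive x y :
  enorm (P (x - s *: gf x) - P (y - s *: gf y)) <= enorm (x - y).
Proof.
apply: le_trans (is_prox_nonexpansive pg cg s0 (proxP _) (proxP _)) _.
exact: (gradient_step_nonexpansive gradf L0 lipg x y cf (ltW s0) sL).
Qed.

Lemma argmin_fin_num y : argmin y -> g y \is a fin_num.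
Proof.
case: pg => gNy [w gwy] [_ /(_ w I)].
rewrite fin_numE gNy /=; apply: contraPneq => ->.
by case: (g w) (gNy w) gwy.
Qed.

(** Moves minimality to real arithmetic; a competitor with infinite [g] cannot do better. *)
Lemma argminP y : argmin y <->
  g y \is a fin_num /\
  forall w, g w \is a fin_num -> f y + fine (g y) <= f w + fine (g w).
Proof.
split=> [my|[gy h]].
  have gy := argmin_fin_num my; split=> // w gw.
  by case: my => _ /(_ w I); rewrite -{1}(fineK gy) -{1}(fineK gw) -!EFinD lee_fin.
split=> // w _.
have [gw|] := boolP (g w \is a fin_num).
  by rewrite -(fineK gy) -(fineK gw) -!EFinD lee_fin h.
rewrite fin_numE (pg.1 w) /= negbK => /eqP ->.
by rewrite addey// leey.
Qed.

(** At a fixed point the subgradient inequality for [g] adds to the gradient inequality for [f].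
    Conversely, the prox inequality tested at [y], minimality tested at [p] and the descent lemma
    bound [D] by [s * L / 2 * D], at most half of [D]. *)
Lemma fixed_prox_gradient_argmin y : P (y - s *: gf y) = y <-> argmin y.
Proof.
have pr := proxP (y - s *: gf y).
have gp := is_prox_fin_num pg s0 pr.
have key := is_prox_dotv_le pg cg s0 pr.
rewrite argminP; split=> [Py|[gy my]].
  rewrite Py in gp key; split=> // w /key.
  rewrite addrAC subrr add0r dotvNl dotvZl => h.
  have : fine (g y) - dotv (gf y) (w - y) <= fine (g w).
    by rewrite -(ler_pM2l s0); lra.
  have := convex_gradient_le gradf lipg y w cf; lra.
set p := P _ in gp key *.
apply/esym/subr_enorm_eq0.
suff : dotv (y - p) (y - p) <= 0 by move=> h; rewrite /enorm ler0_sqrtr.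
have := key _ gy; have := my _ gp.
have := descent_lemma gradf y p lipg.
rewrite -[p - y]opprB dotvNr !dotvNl dotvNr opprK.
rewrite [y - s *: gf y - p]addrAC; move: (y - p) => d.
rewrite dotvDl dotvNl dotvZl.
set D := dotv d d; set G := dotv (gf y) d => h1 h2 h3.
have h : s * (fine (g y) - fine (g p)) <= s * (- G + L / 2 * D).
  by rewrite ler_pM2l//; lra.
have : s * L * D <= D.
  by rewrite ler_piMl ?dotvv_ge0//; move: sL; rewrite ler_pdivlMr.
lra.
Qed.

Lemma argmin_convex y1 y2 (a : R) : 0 < a < 1 ->
  argmin y1 -> argmin y2 -> argmin (a *: y1 + (1 - a) *: y2).
Proof.
move=> a01 /argminP[gy1 m1] /argminP[gy2 m2].
have := cg y1 y2 a01.
set z := _ + _.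
have fz : f z <= a * f y1 + (1 - a) * f y2.
  by apply: cf; case/andP: a01 => a0 a1; rewrite !ltW.
have m12 := m1 _ gy2.
rewrite -(fineK gy1) -(fineK gy2) -!EFinM -EFinD => gz.
have gzf : g z \is a fin_num.
  rewrite fin_numE pg.1 /=; apply: contraTneq gz => ->; by rewrite leye_eq.
apply/argminP; split=> // w gw.
have := m2 _ gw; have := m1 _ gw.
move: gz; rewrite -(fineK gzf) lee_fin => gz.
case/andP: a01 => a0 a1 hw1 hw2.
have : a * (f y1 + fine (g y1)) <= a * (f w + fine (g w)) by rewrite ler_pM2l.
have : (1 - a) * (f y2 + fine (g y2)) <= (1 - a) * (f w + fine (g w)).
  by rewrite ler_pM2l ?subr_gt0.
lra.
Qed.
End ProxGradient.

(** * Real sequences: upper limits and damped recursions *)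

Section Sequences.
Variable R : realType.
Implicit Types (a d w : nat -> R) (e : R).

(** An epsilon form that stays in the reals; for nonnegative sequences it amounts to convergence to
    0. *)
Definition limsup_le0 d :=
  forall e, 0 < e -> exists N, forall k, (N <= k)%N -> d k <= e.

Definition divergent_tails w :=
  forall (A : R) N, exists m, A < \sum_(N <= k < m) w k.

Lemma limn_esup_eq0_limsup_le0 d :
  limn_esup (fun k => (d k)%:E) = 0%E -> limsup_le0 d.
Proof.
move=> d0 e e0.
have : (limn_esup (fun k => (d k)%:E) < e%:E)%E by rewrite d0 lte_fin.
move=> /ereal_inf_lt[_ [V [N _ NV] <-]] Ve.
exists N => k Nk; rewrite -lee_fin; apply: le_trans (ltW Ve).
by apply: ereal_sup_ubound; exists k => //; exact: NV.
Qed.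

Lemma cvg0_limsup_le0 d : d @ \oo --> (0 : R) -> limsup_le0 d.
Proof.
move=> d0 e e0.
have /cvgrPdist_le/(_ e e0)[N _ NP] := d0.
by exists N => k /NP /=; rewrite sub0r normrN; apply: le_trans; exact: ler_norm.
Qed.

Lemma nneseries_divergent_tails w : (forall k, 0 <= w k) ->
  (\sum_(0 <= k <oo) (w k)%:E)%E = +oo%E -> divergent_tails w.
Proof.
move=> w0 woo A N; apply: contrapT => /forallNP h.
suff : (\sum_(0 <= k <oo) (w k)%:E <= (A + \sum_(0 <= k < N) w k)%:E)%E.
  by rewrite woo leye_eq.
apply: lime_le; first by apply: is_cvg_nneseries => k _ _; rewrite lee_fin.
near=> m.
have Nm : (N <= m)%N by near: m; exists N.
rewrite sumEFin lee_fin (big_cat_nat _ Nm) //= addrC lerD2r.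
by rewrite leNgt; apply/negP; exact: h.
Unshelve. all: by end_near. Qed.

Lemma divergent_tailsS w : divergent_tails w -> divergent_tails (fun k => w k.+1).
Proof.
move=> dw A N; have [m hm] := dw A N.+1.
(* The shift moves the upper end to the predecessor; for [m = 0] both sums are empty. *)
by exists m.-1; case: m hm => [|m]; [rewrite !big_geq|rewrite big_add1].
Qed.

Lemma limsup_le0D a d : limsup_le0 a -> limsup_le0 d ->
  limsup_le0 (fun k => a k + d k).
Proof.
move=> ha hd e e0; have e20 : 0 < e / 2 by rewrite divr_gt0.
have [N hN] := ha _ e20; have [M hM] := hd _ e20.
exists (maxn N M) => k; rewrite geq_max => /andP[/hN h1 /hM h2]; lra.
Qed.

Lemma limsup_le0Z d (C : R) : 0 <= C -> limsup_le0 d ->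
  limsup_le0 (fun k => C * d k).
Proof.
move=> C0 hd e e0; have C10 : 0 < C + 1 by lra.
have [N hN] := hd _ (divr_gt0 e0 C10); exists N => k /hN dk.
apply: le_trans (ler_wpM2l C0 dk) _.
rewrite mulrA ler_pdivrMr// mulrDr mulr1 mulrC; lra.
Qed.

Lemma limsup_le0S d : limsup_le0 d -> limsup_le0 (fun k => d k.+1).
Proof.
by move=> hd e e0; have [N hN] := hd _ e0; exists N => k Nk; apply: hN; exact: leqW.
Qed.

Lemma limsup_le0_le a d : (exists N, forall k, (N <= k)%N -> a k <= d k) ->
  limsup_le0 d -> limsup_le0 a.
Proof.
move=> [M hM] hd e e0; have [N hN] := hd _ e0.
exists (maxn N M) => k; rewrite geq_max => /andP[/hN h1 /hM h2].
exact: le_trans h1.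
Qed.

(** Once [d] is at most [g * e / 2], each step with [a k] above [e] lowers [a] by at least
    [g * e / 2 * w k]. Divergence of the weights forces [a] to reach [e], and from then on the bound
    [e] is preserved. *)
Lemma damped_recursion_limsup_le0 (g : R) a w d : 0 < g -> (forall k, 0 <= a k) ->
  (forall k, 0 < w k) -> (forall k, g * w k <= 1) ->
  (forall k, a k.+1 <= (1 - g * w k) * a k + w k * d k) ->
  limsup_le0 d -> divergent_tails w -> limsup_le0 a.
Proof.
move=> g0 a0 w0 gw rec hd dw e e0.
have ge0 : 0 < g * e / 2 by rewrite !divr_gt0 ?mulr_gt0.
have [N hN] := hd _ ge0.
have [K [NK aK]] : exists K, (N <= K)%N /\ a K <= e.
  apply: contrapT => /forallNP h.
  have ae k : (N <= k)%N -> e < a k.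
    by move=> Nk; rewrite ltNge; apply/negP => ake; apply: (h k).
  have dec m : a (N + m)%N <= a N - g * e / 2 * \sum_(N <= k < N + m) w k.
    elim: m => [|m IH]; first by rewrite addn0 big_geq// mulr0 subr0.
    rewrite addnS big_nat_recr ?leq_addr//=.
    have Nm : (N <= N + m)%N by exact: leq_addr.
    have h1 := rec (N + m)%N.
    have h2 : w (N + m)%N * d (N + m)%N <= w (N + m)%N * (g * e / 2).
      by rewrite ler_pM2l// hN.
    have h3 : g * w (N + m)%N * e <= g * w (N + m)%N * a (N + m)%N.
      by rewrite ler_pM2l ?mulr_gt0//; exact/ltW/ae.
    lra.
  (* Up to this [m] the total decrease exceeds [a N], so [a m] would be negative. *)
  have [m hm] := dw (a N / (g * e / 2)) N.
  have [Nm|mN] := leqP N m; last first.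
    move: hm; rewrite big_geq ?(ltnW mN)// ltNge => /negP; apply.
    by rewrite divr_ge0 ?a0 ?(ltW ge0).
  have := dec (m - N)%N; rewrite subnKC//.
  move: hm; rewrite ltr_pdivrMr// => h1 h2.
  have := a0 m; lra.
exists K => k /subnKC <-; elim: (k - K)%N => [|m IH]; first by rewrite addn0.
rewrite addnS; apply: le_trans (rec _) _.
have NKm : (N <= K + m)%N by exact: leq_trans NK (leq_addr _ _).
have h2 : w (K + m)%N * d (K + m)%N <= w (K + m)%N * (g * e / 2).
  by rewrite ler_pM2l// hN.
have h3 : (1 - g * w (K + m)%N) * a (K + m)%N <= (1 - g * w (K + m)%N) * e.
  by rewrite ler_wpM2l// subr_ge0.
have h4 : 0 < w (K + m)%N * (g * e / 2) by rewrite mulr_gt0.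
lra.
Qed.

(** Any bound at least [C / g] is preserved from [N] on; the sum of the first terms covers the
    earlier indices. *)
Lemma damped_recursion_bounded (g C : R) a w N : 0 < g -> 0 <= C ->
  (forall k, 0 <= a k) -> (forall k, 0 < w k) -> (forall k, g * w k <= 1) ->
  (forall k, (N <= k)%N -> a k.+1 <= (1 - g * w k) * a k + w k * C) ->
  exists B, 0 <= B /\ forall k, a k <= B.
Proof.
move=> g0 C0 a0 w0 gw rec.
have S0 m : 0 <= \sum_(i < m) a i by exact: sumr_ge0.
have Cg : 0 <= C / g by rewrite divr_ge0 // ltW.
exists (\sum_(i < N.+1) a i + C / g); split; first by rewrite addr_ge0.
have small k : (k <= N)%N -> a k <= \sum_(i < N.+1) a i + C / g.
  move=> kN; rewrite ler_wpDr// (bigD1 (Ordinal (kN : (k < N.+1)%N))) //= lerDl.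
  by apply: sumr_ge0.
move=> k; have [/small//|/ltnW/subnKC <-] := leqP k N.
elim: (k - N)%N => [|m IH]; first by rewrite addn0 small.
rewrite addnS; set B := _ + _ in IH *; apply: le_trans (rec _ (leq_addr _ _)) _.
have h3 : (1 - g * w (N + m)%N) * a (N + m)%N <= (1 - g * w (N + m)%N) * B.
  by rewrite ler_wpM2l// subr_ge0.
have h4 : w (N + m)%N * C <= w (N + m)%N * (g * B).
  by rewrite ler_pM2l// mulrC -ler_pdivrMr// /B lerDr.
lra.
Qed.
End Sequences.

(** * Strong convergence of the perturbed viscosity iteration *)

Section Viscosity.
Variables (R : realType) (n : nat) (S T W : 'rV[R]_n -> 'rV[R]_n) (r : R).
Hypotheses (r0 : 0 <= r) (r1 : r < 1).
Hypothesis contrS : forall x y, enorm (S x - S y) <= r * enorm (x - y).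
Hypothesis nonexpT : forall x y, enorm (T x - T y) <= enorm (x - y).
Hypothesis nonexpW : forall x y, enorm (W x - W y) <= enorm (x - y).
Variable xs : 'rV[R]_n.
Hypothesis Wxs : W xs = xs.
Hypothesis VIxs : forall y, W y = y -> 0 <= dotv (xs - S xs) (y - xs).

Lemma enorm_sub_image_lipschitz x y :
  `|enorm (x - W x) - enorm (y - W y)| <= 2 * enorm (x - y).
Proof.
have h1 := enorm_trian y x (W x); have h2 := enorm_trian x y (W y).
have h3 := enorm_trian (W y) y (W x); have h4 := enorm_trian (W x) x (W y).
have := nonexpW x y; move: h2 h3; rewrite (enormB y x) (enormB (W y)) => h2 h3.
rewrite ler_norml; lra.
Qed.

Lemma asymptotic_variational (B e : R) : 0 < e -> exists delta, 0 < delta /\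
  forall z, enorm (z - xs) <= B -> enorm (z - W z) <= delta ->
    dotv (S xs - xs) (z - xs) <= e.
Proof.
move=> e0.
pose K := [set z | dotv (xs - S xs) (z - xs) <= - e] `&` [set z | enorm (z - xs) <= B].
have cK : compact K.
  apply: compact_enorm_ball.
  apply: (@closed_sublevel _ _ (enorm (xs - S xs))) => x y.
  rewrite -dotvNr -dotvDr opprB addrA subrK.
  exact: cauchy_schwarz.
have [K0|/set0P/negP/negPn/eqP K0] := pselect (K !=set0); last first.
  exists 1; split=> // z zB _; rewrite leNgt; apply/negP => ez.
  suff : K z by rewrite K0.
  split=> //=; move: ez; rewrite -[S xs - xs]opprB dotvNl; lra.
have [|c] := @EVT_min_rV _ _ (fun z => enorm (z - W z)) K K0 cK.
  apply: continuous_subspaceT.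
  exact: enorm_lipschitz_continuous enorm_sub_image_lipschitz.
rewrite inE => -[/= ce _] cmin.
have c0 : 0 < enorm (c - W c).
  rewrite lt_neqAle enorm_ge0 andbT eq_sym; apply/eqP => /subr_enorm_eq0/esym/VIxs.
  lra.
exists (enorm (c - W c) / 2); split; first by rewrite divr_gt0.
move=> z zB zW; rewrite leNgt; apply/negP => ez.
have := cmin z; rewrite inE => h.
have {}h : enorm (c - W c) <= enorm (z - W z).
  apply: h; split=> //=; move: ez; rewrite -[S xs - xs]opprB dotvNl; lra.
lra.
Qed.

(** The weights are arguments so that consecutive steps can be compared at a common point. *)
Let F a b z := a *: S z + ((1 - a) * b) *: T z + ((1 - a) * (1 - b)) *: W z.

Lemma enorm_comb3 (a b c : R) (p q w : 'rV[R]_n) : 0 <= a -> 0 <= b -> 0 <= c ->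
  enorm (a *: p + b *: q + c *: w) <= a * enorm p + b * enorm q + c * enorm w.
Proof.
move=> a0 b0 c0; apply: le_trans (enormD3 _ _ _) _.
by rewrite !enormZ !ger0_norm.
Qed.

Lemma viscosity_step_contraction (a b : R) z y : 0 < a < 1 -> 0 < b < 1 ->
  enorm (F a b z - F a b y) <= (1 - (1 - r) * a) * enorm (z - y).
Proof.
move=> /andP[a0 a1] /andP[b0 b1].
have -> : F a b z - F a b y = a *: (S z - S y) + ((1 - a) * b) *: (T z - T y) +
    ((1 - a) * (1 - b)) *: (W z - W y).
  by rewrite /F !scalerBr; apply/rowP => i; rewrite !mxE; ring.
have a10 : 0 <= 1 - a by lra.
have b10 : 0 <= 1 - b by lra.
apply: le_trans (enorm_comb3 _ _ _ (ltW a0) _ _) _; rewrite ?mulr_ge0 ?(ltW b0)//.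
have h1 : a * enorm (S z - S y) <= a * (r * enorm (z - y)).
  by rewrite ler_pM2l.
have h2 : ((1 - a) * b) * enorm (T z - T y) <= ((1 - a) * b) * enorm (z - y).
  by rewrite ler_wpM2l// mulr_ge0// ltW.
have h3 : ((1 - a) * (1 - b)) * enorm (W z - W y) <= ((1 - a) * (1 - b)) * enorm (z - y).
  by rewrite ler_wpM2l// mulr_ge0.
lra.
Qed.

Lemma viscosity_step_diff (a b : R) z :
  F a b z - W z = a *: (S z - W z) + ((1 - a) * b) *: (T z - W z).
Proof. by rewrite /F !scalerBr; apply/rowP => i; rewrite !mxE; ring. Qed.

Lemma viscosity_step_param (a b a' b' C : R) z : 0 < a < 1 -> 0 < b' < 1 ->
  enorm (S z - W z) <= C -> enorm (T z - W z) <= C ->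
  enorm (F a' b' z - F a b z) <= (`|b' - b| + `|a' - a|) * (2 * C).
Proof.
move=> /andP[a0 a1] /andP[b0 b1] SC TC.
have -> : F a' b' z - F a b z =
    (a' - a) *: (S z - W z) + ((1 - a') * b' - (1 - a) * b) *: (T z - W z).
  by rewrite /F !scalerBr; apply/rowP => i; rewrite !mxE; ring.
apply: le_trans (enormD _ _) _; rewrite !enormZ.
have h : `|(1 - a') * b' - (1 - a) * b| <= `|b' - b| + `|a' - a|.
  (* In this splitting both coefficients, [1 - a] and [b'], lie in (0, 1). *)
  rewrite (_ : _ - _ = (1 - a) * (b' - b) - b' * (a' - a)); last by ring.
  apply: le_trans (ler_normB _ _) _; rewrite !normrM.
  apply: lerD; rewrite ler_piMl// ger0_norm; lra.
have h0 := normr_ge0 (b' - b).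
have h1 : `|a' - a| * enorm (S z - W z) <= (`|b' - b| + `|a' - a|) * C.
  by apply: ler_pM => //; [exact: enorm_ge0|lra].
have h2 : `|(1 - a') * b' - (1 - a) * b| * enorm (T z - W z) <=
    (`|b' - b| + `|a' - a|) * C.
  by apply: ler_pM => //; exact: enorm_ge0.
lra.
Qed.

Variables (alpha beta : nat -> R) (x : nat -> 'rV[R]_n).
Hypothesis alpha01 : forall k, 0 < alpha k < 1.
Hypothesis beta01 : forall k, 0 < beta k < 1.
Hypothesis rec : forall k, x k.+1 = F (alpha k) (beta k) (x k).
Hypothesis beta_alpha : limsup_le0 (fun k => beta k / alpha k).
Hypothesis alpha_cvg0 : limsup_le0 alpha.
Hypothesis alpha_div : divergent_tails alpha.
Hypothesis variation :
  limsup_le0 (fun k => (`|beta k.+1 - beta k| + `|alpha k.+1 - alpha k|) / alpha k.+1).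

Let alpha_gt0 k : 0 < alpha k. Proof. by case/andP: (alpha01 k). Qed.
Let g0 : 0 < 1 - r. Proof. by rewrite subr_gt0. Qed.

Let gw k : (1 - r) * alpha k <= 1.
Proof.
have /andP[a0 a1] := alpha01 k.
have : 0 <= r * alpha k by rewrite mulr_ge0// ltW.
lra.
Qed.

Let beta_le_alpha : exists N, forall k, (N <= k)%N -> beta k <= alpha k.
Proof.
have [N hN] := beta_alpha ltr01.
by exists N => k /hN; rewrite ler_pdivrMr// mul1r.
Qed.

(** A contracted error plus a drift, present because [xs] is fixed by [W] but possibly not by [S]
    and [T]. *)
Let xSE k : x k.+1 - xs = (F (alpha k) (beta k) (x k) - F (alpha k) (beta k) xs) +
  (alpha k *: (S xs - xs) + ((1 - alpha k) * beta k) *: (T xs - xs)).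
Proof.
have := viscosity_step_diff (alpha k) (beta k) xs; rewrite Wxs => <-.
by rewrite rec addrA subrK.
Qed.

Lemma viscosity_bounded : exists B, 0 <= B /\ forall k, enorm (x k - xs) <= B.
Proof.
have [N hN] := beta_le_alpha.
apply: (@damped_recursion_bounded _ (1 - r) (enorm (S xs - xs) + enorm (T xs - xs))
  (fun k => enorm (x k - xs)) alpha N) => //.
- by rewrite addr_ge0 ?enorm_ge0.
- by move=> k; exact: enorm_ge0.
move=> k /hN ba; rewrite xSE.
apply: le_trans (enormD _ _) _; apply: lerD.
  exact: viscosity_step_contraction.
apply: le_trans (enormD _ _) _; rewrite mulrDr !enormZ (gtr0_norm (alpha_gt0 k)).
rewrite lerD2l; apply: ler_wpM2r; first exact: enorm_ge0.
have /andP[a0 a1] := alpha01 k; have /andP[b0 b1] := beta01 k.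
have : 0 < alpha k * beta k by rewrite mulr_gt0.
rewrite ger0_norm; first by lra.
by rewrite mulr_ge0 ?subr_ge0 ?(ltW a1) ?(ltW b0).
Qed.

Let image_diff_bounded : exists C, 0 <= C /\
  forall k, enorm (S (x k) - W (x k)) <= C /\ enorm (T (x k) - W (x k)) <= C.
Proof.
have [B [B0 hB]] := viscosity_bounded.
have c1 := enorm_ge0 (S xs - xs); have c2 := enorm_ge0 (T xs - xs).
exists (2 * B + enorm (S xs - xs) + enorm (T xs - xs)); split; first by lra.
move=> k; have xB := hB k.
have hW : enorm (xs - W (x k)) <= B.
  by rewrite -{1}Wxs enormB; apply: le_trans (nonexpW _ _) _.
have hT := nonexpT (x k) xs.
have hS : enorm (S (x k) - S xs) <= enorm (x k - xs).
  by apply: le_trans (contrS _ _) _; rewrite ler_piMl ?enorm_ge0// ltW.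
have := enorm_trian (S xs) (S (x k)) (W (x k)).
have := enorm_trian xs (S xs) (W (x k)).
have := enorm_trian (T xs) (T (x k)) (W (x k)).
have := enorm_trian xs (T xs) (W (x k)).
by move=> *; split; lra.
Qed.

Lemma viscosity_asymptotically_regular :
  limsup_le0 (fun k => enorm (x k.+1 - x k)).
Proof.
have [C [C0 hC]] := image_diff_bounded.
apply: (@damped_recursion_limsup_le0 _ (1 - r) _ (fun k => alpha k.+1)
  (fun k => 2 * C *
     ((`|beta k.+1 - beta k| + `|alpha k.+1 - alpha k|) / alpha k.+1))) => //.
- by move=> k; exact: enorm_ge0.
- move=> k; rewrite (rec k.+1) {2}(rec k).
  (* Insert the new weights at the old point: one difference is contracted, the other only sees the
     change of weights. *)
  apply: le_trans (enorm_trian (F (alpha k.+1) (beta k.+1) (x k)) _ _) _.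
  apply: lerD; first exact: viscosity_step_contraction.
  have [SC TC] := hC k.
  apply: le_trans (viscosity_step_param (beta k) (alpha k.+1) (alpha01 k)
    (beta01 k.+1) SC TC) _.
  rewrite [leRHS]mulrCA mulrC ler_wpM2l ?mulr_ge0//.
  by rewrite mulrC mulfVK// gt_eqF.
- by apply: limsup_le0Z => //; rewrite mulr_ge0.
- exact: divergent_tailsS.
Qed.

Lemma viscosity_fixed_residual : limsup_le0 (fun k => enorm (x k - W (x k))).
Proof.
have [C [C0 hC]] := image_diff_bounded.
have [N hN] := beta_le_alpha.
have C20 : 0 <= 2 * C by rewrite mulr_ge0.
apply: limsup_le0_le (limsup_le0D viscosity_asymptotically_regular
  (limsup_le0Z C20 alpha_cvg0)).
exists N => k /hN ba.
(* The second piece, [x k.+1 - W (x k)], is at most [2 * C * alpha k] once [beta k <= alpha k]. *)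
apply: le_trans (enorm_trian (x k.+1) _ _) _.
rewrite enormB lerD2l rec viscosity_step_diff.
apply: le_trans (enormD _ _) _.
have [SC TC] := hC k.
have /andP[a0 a1] := alpha01 k; have /andP[b0 b1] := beta01 k.
rewrite !enormZ (gtr0_norm a0).
have ab0 : 0 < alpha k * beta k by rewrite mulr_gt0.
rewrite ger0_norm; last by rewrite mulr_ge0 ?subr_ge0 ?(ltW a1) ?(ltW b0).
have h1 : alpha k * enorm (S (x k) - W (x k)) <= alpha k * C.
  by rewrite ler_pM2l.
have h2 : (1 - alpha k) * beta k * enorm (T (x k) - W (x k)) <= alpha k * C.
  apply: ler_pM => //; try exact: enorm_ge0; last by lra.
  by rewrite mulr_ge0 ?subr_ge0 ?(ltW a1) ?(ltW b0).
lra.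
Qed.

Lemma viscosity_variational :
  limsup_le0 (fun k => dotv (S xs - xs) (x k - xs)).
Proof.
move=> e e0; have [B [B0 hB]] := viscosity_bounded.
have [delta [d0 hd]] := asymptotic_variational B e0.
have [N hN] := viscosity_fixed_residual d0.
by exists N => k /hN; apply: hd.
Qed.

Lemma viscosity_strong_convergence : x @ \oo --> xs.
Proof.
have [B [B0 hB]] := viscosity_bounded.
have C2 := enorm_ge0 (T xs - xs).
have C20 : 0 <= 2 * (enorm (T xs - xs) * B) by rewrite !mulr_ge0.
have sq0 : limsup_le0 (fun k => enorm (x k - xs) ^+ 2).
  apply: (@damped_recursion_limsup_le0 _ (1 - r) _ alpha
    (fun k => 2 * dotv (S xs - xs) (x k.+1 - xs) +
       2 * (enorm (T xs - xs) * B) * (beta k / alpha k))) => //.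
  - by move=> k; exact: sqr_ge0.
  - move=> k.
    have /andP[a0 a1] := alpha01 k; have /andP[b0 b1] := beta01 k.
    set p := F (alpha k) (beta k) (x k) - F (alpha k) (beta k) xs.
    set q := alpha k *: (S xs - xs) + ((1 - alpha k) * beta k) *: (T xs - xs).
    have xE : x k.+1 - xs = p + q by exact: xSE.
    (* Pairing [q] with the new error [p + q] leaves only a discarded [- dotv q q]; hence the
       shifted index in the inner product. *)
    have h1 : enorm (x k.+1 - xs) ^+ 2 <= enorm p ^+ 2 + 2 * dotv q (x k.+1 - xs).
      rewrite !enorm_sqr xE; have := dotvv_ge0 q; clearbody p q.
      rewrite !dotE (dotvC q p); lra.
    have hp : enorm p ^+ 2 <= (1 - (1 - r) * alpha k) * enorm (x k - xs) ^+ 2.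
      have := viscosity_step_contraction (x k) xs (alpha01 k) (beta01 k).
      rewrite -/p => pc.
      apply: (@le_trans _ _ (((1 - (1 - r) * alpha k) * enorm (x k - xs)) ^+ 2)).
        rewrite ler_pXn2r ?nnegrE ?enorm_ge0//.
        by rewrite mulr_ge0 ?enorm_ge0// subr_ge0.
      (* The contraction factor lies in [0, 1], so its square is at most itself. *)
      rewrite exprMn ler_wpM2r ?sqr_ge0// expr2 ler_piMl ?subr_ge0//.
      by rewrite gerBl mulr_ge0// ltW.
    have hq : dotv q (x k.+1 - xs) <=
        alpha k * dotv (S xs - xs) (x k.+1 - xs) + beta k * (enorm (T xs - xs) * B).
      rewrite /q [leLHS]dotvDl 2!dotvZl lerD2l.
      have ht : dotv (T xs - xs) (x k.+1 - xs) <= enorm (T xs - xs) * B.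
        by apply: le_trans (dotv_le_enorm _ _) _; rewrite ler_wpM2l.
      have hb : (1 - alpha k) * beta k <= beta k by rewrite ler_piMl; lra.
      apply: (@le_trans _ _ ((1 - alpha k) * beta k * (enorm (T xs - xs) * B))).
        by rewrite ler_wpM2l// mulr_ge0; lra.
      by rewrite ler_wpM2r ?mulr_ge0.
    have -> : alpha k * (2 * dotv (S xs - xs) (x k.+1 - xs) +
       2 * (enorm (T xs - xs) * B) * (beta k / alpha k)) =
       2 * (alpha k * dotv (S xs - xs) (x k.+1 - xs) + beta k * (enorm (T xs - xs) * B)).
      by field; rewrite gt_eqF.
    lra.
  - apply: limsup_le0D; last exact: limsup_le0Z.
    apply: limsup_le0Z => //.
    exact: (limsup_le0S viscosity_variational).
apply/cvgrPdist_le => e e0.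
have [N hN] := sq0 _ (exprn_gt0 2 e0).
exists N => // k /= /hN; rewrite ler_pXn2r ?nnegrE ?enorm_ge0 ?(ltW e0)// => h.
by rewrite distrC; apply: le_trans (mx_norm_le_enorm _) _.
Qed.
End Viscosity.

(** * Minimizing a strongly convex function over a closed convex set *)

Section ConstrainedMin.
Variables (R : realType) (n : nat) (f : 'rV[R]_n -> R) (gf : 'rV[R]_n -> 'rV[R]_n).
Variables (L mu : R) (A : set 'rV[R]_n).
Hypotheses (gradf : is_gradient f gf) (lipg : lipschitz_with L gf).
Hypotheses (mu0 : 0 < mu) (scf : strongly_convex mu f).

Lemma strongly_convex_min_exists : closed A -> A !=set0 ->
  exists2 z, A z & forall y, A y -> f z <= f y.
Proof.
(* Beyond this radius the quadratic term outweighs the linear one at [y0], so [f] is at least [f y0]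
   there and the compact part of [A] suffices. *)
move=> clA [y0 Ay0]; pose B := 2 * enorm (gf y0) / mu.
have B0 : 0 <= B by rewrite divr_ge0 ?mulr_ge0 ?enorm_ge0// ltW.
have y0B : enorm (y0 - y0) <= B by rewrite subrr enorm0.
have [||z zK zmin] := @EVT_min_rV _ _ f (A `&` [set x | enorm (x - y0) <= B]) _
    (compact_enorm_ball clA).
- by exists y0.
- apply: continuous_subspaceT => x.
  by apply: differentiable_continuous; have [] := gradf x.
move: zK; rewrite inE => -[Az _].
exists z => // y Ay.
have [yB|yB] := leP (enorm (y - y0)) B; first by apply: zmin; rewrite inE.
apply: (@le_trans _ _ (f y0)); first by apply: zmin; rewrite inE.
apply: le_trans (strongly_convex_gradient_le gradf lipg y0 y (ltW mu0) scf).
have := cauchy_schwarz (gf y0) (y - y0); rewrite ler_norml => /andP[h _].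
suff : enorm (gf y0) * enorm (y - y0) <= mu / 2 * dotv (y - y0) (y - y0) by lra.
rewrite -enorm_sqr expr2 mulrA ler_wpM2r ?enorm_ge0//.
by move: yB; rewrite ltr_pdivrMr// => yB; lra.
Qed.

(** Move from [z] towards [y] by a fraction [a]: minimality and the descent lemma bound the slope up
    to order [a]. *)
Lemma constrained_min_variational z :
  (forall x y (a : R), 0 < a < 1 -> A x -> A y -> A (a *: x + (1 - a) *: y)) ->
  A z -> (forall y, A y -> f z <= f y) ->
  forall y, A y -> 0 <= dotv (gf z) (y - z).
Proof.
move=> cvxA Az zmin y Ay.
rewrite -oppr_le0.
apply: (@le0_of_le_small _ _ (L / 2 * dotv (y - z) (y - z))) => a a01.
have := zmin _ (cvxA _ _ _ a01 Ay Az).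
have := descent_lemma gradf z (a *: y + (1 - a) *: z) lipg.
have -> : a *: y + (1 - a) *: z - z = a *: (y - z).
  by apply/rowP => i; rewrite !mxE; ring.
case/andP: a01 => a0 a1.
rewrite !dotvZl !dotvZr => h1 h2.
rewrite -(ler_pM2l a0); lra.
Qed.

(** The two inequalities contradict strong monotonicity of the gradient unless the points agree. *)
Lemma variational_unique z1 z2 : 0 <= dotv (gf z1) (z2 - z1) ->
  0 <= dotv (gf z2) (z1 - z2) -> z1 = z2.
Proof.
have := strongly_convex_monotone gradf lipg z1 z2 (ltW mu0) scf.
rewrite [leRHS]dotvDl dotvNl -[z2 - z1]opprB dotvNr => h h1 h2.
apply/subr_enorm_eq0.
rewrite /enorm ler0_sqrtr// -(ler_pM2l mu0) mulr0; lra.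
Qed.
End ConstrainedMin.

(** * Convergence of the trilevel iteration *)

Theorem mainTheorem4 (R : realType) (n : nat)
  (f1 f2 : 'rV[R]_n -> R) (gf1 gf2 : 'rV[R]_n -> 'rV[R]_n) (Lf1 Lf2 : R)
  (g1 g2 : 'rV[R]_n -> \bar R)
  (om : 'rV[R]_n -> R) (gom : 'rV[R]_n -> 'rV[R]_n) (mu Lom : R)
  (u t s : R) (P1 P2 : 'rV[R]_n -> 'rV[R]_n)
  (alpha beta : nat -> R) (x : nat -> 'rV[R]_n) :
  (* f_i convex, C^1 with L_{f_i}-Lipschitz gradient *)
  convex_fun f1 -> is_gradient f1 gf1 -> continuous gf1 ->
  0 < Lf1 -> lipschitz_with Lf1 gf1 ->
  convex_fun f2 -> is_gradient f2 gf2 -> continuous gf2 ->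
  0 < Lf2 -> lipschitz_with Lf2 gf2 ->
  (* g_i proper, lsc, convex *)
  proper_efun g1 -> lower_semicontinuous g1 -> convex_efun g1 ->
  proper_efun g2 -> lower_semicontinuous g2 -> convex_efun g2 ->
  (* omega mu-strongly convex, C^1 with L_omega-Lipschitz gradient *)
  0 < mu -> strongly_convex mu om -> is_gradient om gom -> continuous gom ->
  0 < Lom -> lipschitz_with Lom gom ->
  (* Y* and X* nonempty *)
  (exists y, is_argmin_on setT (fun z => ((f2 z)%:E + g2 z)%E) y) ->
  (exists y, is_argmin_on
       [set z | is_argmin_on setT (fun z => ((f2 z)%:E + g2 z)%E) z]
       (fun z => ((f1 z)%:E + g1 z)%E) y) ->
  (* step sizes *)
  0 < u <= 2 / (Lom + mu) -> 0 < t <= 1 / Lf1 -> 0 < s <= 1 / Lf2 ->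
  (* P1 = prox_{t g1}, P2 = prox_{s g2} *)
  (forall z, is_prox t g1 z (P1 z)) -> (forall z, is_prox s g2 z (P2 z)) ->
  (* parameters *)
  (forall k, 0 < alpha k < 1) -> (forall k, 0 < beta k < 1) ->
  (* trilevel iteration, with S z = z - u grad om z, T z = P1 (z - t grad f1 z),
     W z = P2 (z - s grad f2 z) *)
  (forall k, x k.+1 =
      alpha k *: (x k - u *: gom (x k))
    + ((1 - alpha k) * beta k) *: P1 (x k - t *: gf1 (x k))
    + ((1 - alpha k) * (1 - beta k)) *: P2 (x k - s *: gf2 (x k))) ->
  (* assumptions on alpha, beta *)
  limn_esup (fun k => (beta k / alpha k)%:E) = 0%E ->
  alpha @ \oo --> (0 : R) ->
  (\sum_(0 <= k <oo) (alpha k)%:E)%E = +oo%E ->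
  limn_esup (fun k =>
     ((`|beta k.+1 - beta k| + `|alpha k.+1 - alpha k|)
        / (alpha k.+1 * beta k.+1))%:E) = 0%E ->
  (* conclusion *)
  exists xs : 'rV[R]_n,
    [/\ P2 (xs - s *: gf2 xs) = xs,
        (forall y, P2 (y - s *: gf2 y) = y ->
           0 <= dotv (xs - (xs - u *: gom xs)) (y - xs)),
        (forall z, P2 (z - s *: gf2 z) = z ->
           (forall y, P2 (y - s *: gf2 y) = y ->
              0 <= dotv (z - (z - u *: gom z)) (y - z)) -> z = xs),
        is_argmin_on
          [set z | is_argmin_on setT (fun z => ((f2 z)%:E + g2 z)%E) z]
          (fun z => (om z)%:E) xs
      & x @ \oo --> xs].
Proof.
move=> cf1 gradf1 _ L1 lip1 cf2 gradf2 _ L2 lip2 pg1 _ cg1 pg2 _ cg2.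
move=> mu0 sc gradom _ L0 lipom [y0 my0] _ /andP[u0 uL] /andP[t0 tL] /andP[s0 sL].
move=> prox1 prox2 alpha01 beta01 rec hba halpha hdiv hvar.
have [r [r0 r1 contrS]] := gradient_step_contraction gradom L0 lipom mu0 sc u0 uL.
have nonexpT := prox_gradient_nonexpansive cf1 gradf1 L1 lip1 pg1 cg1 t0 tL prox1.
have nonexpW := prox_gradient_nonexpansive cf2 gradf2 L2 lip2 pg2 cg2 s0 sL prox2.
have fixE := fixed_prox_gradient_argmin cf2 gradf2 L2 lip2 pg2 cg2 s0 sL prox2.
pose W z := P2 (z - s *: gf2 z).
have clW : closed [set z | W z = z].
  rewrite (_ : [set z | _] = [set z | enorm (z - W z) <= 0]).
    exact: closed_sublevel (enorm_sub_image_lipschitz nonexpW).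
  apply/seteqP; split=> z /=; first by move=> ->; rewrite subrr enorm0.
  by move=> h; apply/esym/subr_enorm_eq0/le_anti; rewrite h enorm_ge0.
have cvxW a b (c : R) : 0 < c < 1 -> W a = a -> W b = b ->
    W (c *: a + (1 - c) *: b) = c *: a + (1 - c) *: b.
  by move=> c01 /fixE ma /fixE mb; apply/fixE; exact: argmin_convex.
(* The limit is the minimizer of [om] over the fixed points of [W]. By [subE], its first-order
   condition is the variational inequality for [S] up to the positive factor [u]. *)
have [|xs Wxs xsmin] := strongly_convex_min_exists gradom lipom mu0 sc clW.
  by exists y0; apply/fixE.
have VI := constrained_min_variational gradom lipom cvxW Wxs xsmin.
have subE (z y : 'rV[R]_n) : dotv (z - (z - u *: gom z)) y = u * dotv (gom z) y.
  by rewrite opprB addrC subrK dotvZl.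
exists xs; split.
- exact: Wxs.
- by move=> y Wy; rewrite subE pmulr_rge0// VI.
- move=> z Wz VIz; apply: (variational_unique gradom lipom mu0 sc); last exact: VI.
  by have := VIz _ Wxs; rewrite subE pmulr_rge0.
- by split; [exact/fixE | move=> y /fixE Wy; rewrite lee_fin; exact: xsmin].
apply: (@viscosity_strong_convergence _ _ (fun z => z - u *: gom z)
  (fun z => P1 (z - t *: gf1 z)) W r r0 r1 contrS nonexpT nonexpW xs Wxs _
  alpha beta x alpha01 beta01 rec) => //.
- by move=> y Wy; rewrite subE mulr_ge0 ?(ltW u0)//; exact: VI.
- exact: limn_esup_eq0_limsup_le0.
- exact: cvg0_limsup_le0.
- by apply: nneseries_divergent_tails => // k; case/andP: (alpha01 k) => /ltW.
(* As [beta k.+1] is below 1, the quotient by [alpha k.+1 * beta k.+1] dominates the quotient by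
   [alpha k.+1]. *)
apply: limsup_le0_le (limn_esup_eq0_limsup_le0 hvar).
exists 0%N => k _; have /andP[a0 _] := alpha01 k.+1; have /andP[b0 b1] := beta01 k.+1.
rewrite ler_wpM2l ?addr_ge0// lef_pV2 ?posrE ?mulr_gt0//.
by rewrite ler_piMr ?ltW.
Qed.
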